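(* Let $(\mathcal{T},\varphi,\gamma)$ be a double monoidal monad on a duoidal category $(\mathsf{C},\diamond,I,\star,J)$. Assume that $\mathsf{C}$ admits reflexive coequalizers and that these are preserved by $\mathcal{T}$, $\diamond$ and $\star$. Then $(\mathsf{C}^{\mathcal{T}},\diamond^{\varphi},\mathcal{T}I,\star^{\gamma},\mathcal{T}J)$ (with the interchange law and unit maps described in the context) is a duoidal category. Moreover, the free algebra functor $$\mathcal{F}^{\mathcal{T}}:(\mathsf{C},\diamond,\star)\to(\mathsf{C}^{\mathcal{T}},\diamond^{\varphi},\star^{\gamma})$$ is double strong monoidal.
   Context: Monoidal categories are treated as if strict. A reflexive coequalizer is a coequalizer of a pair of maps with a common section. **Duoidal category.** A category $\mathsf{C}$ with two monoidal structures $(\diamond,I)$, $(\star,J)$, a natural transformation (interchange law) $\zeta_{A,B,C,D}:(A\star B)\diamond(C\star D)\to(A\diamond C)\star(B\diamond D)$ and unit maps $\delta:I\to I\star I$, $\theta:J\diamond J\to J$, $\zeta_0:I\to J$ such that: $\zeta(\zeta\diamond\mathrm{id})=\zeta(\mathrm{id}\diamond\zeta)$ as maps $(A\star X)\diamond(B\star Y)\diamond(C\star Z)\to(A\diamond B\diamond C)\star(X\diamond Y\diamond Z)$; $(\zeta\star\mathrm{id})\zeta=(\mathrm{id}\star\zeta)\zeta$ as maps $(A\star B\star C)\diamond(X\star Y\star Z)\to(A\diamond X)\star(B\diamond Y)\star(C\diamond Z)$; the composites $A\star B=I\diamond(A\star B)\xrightarrow{\delta\diamond\mathrm{id}}(I\star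 I)\diamond(A\star B)\xrightarrow{\zeta}(I\diamond A)\star(I\diamond B)=A\star B$ and $A\diamond B=(J\star A)\diamond(J\star B)\xrightarrow{\zeta}(J\diamond J)\star(A\diamond B)\xrightarrow{\theta\star\mathrm{id}}J\star(A\diamond B)=A\diamond B$, and their right-handed versions, are identities; $(J,\theta,\zeta_0)$ is a monoid in $(\mathsf{C},\diamond,I)$; $(I,\delta,\zeta_0)$ is a comonoid in $(\mathsf{C},\star,J)$. **Double monoidal monad.** A monad $(\mathcal{T},\mu,\eta)$ on a monoidal category is monoidal if the functor carries a lax monoidal structure for which $\mu,\eta$ are morphisms of monoidal functors. A double monoidal monad on $\mathsf{C}$ is a monad $\mathcal{T}$ with structures $\varphi$ and $\gamma$ making it monoidal on $(\mathsf{C},\diamond,I)$ and on $(\mathsf{C},\star,J)$ respectively, such that $\mathcal{T}\zeta\circ\varphi\circ(\gamma\diamond\gamma)=\gamma\circ(\varphi\star\varphi)\circ\zeta$ as maps $(\mathcal{T}A\star\mathcal{T}B)\diamond(\mathcal{T}C\star\mathcal{T}D)\to\mathcal{T}((A\diamond C)\star(B\diamond D))$; $\gamma\circ(\varphi_0\star\varphi_0)\circ\delta=\mathcal{T}\delta\circ\varphi_0$; $\gamma_0\circ\theta=\mathcal{T}\theta\circ\varphi\circ(\gamma_0\diamond\gamma_0)$; $\gamma_0\circ\zeta_0=\mathcal{T}\zeta_0\circ\varphi_0$. **Monoidal structures on $\mathsf{C}^{\mathcal{T}}$.** For $\mathcal{T}$-algebras $(V_i,v_i)$, $(W,w)$,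 a map $f:V_1\diamond\cdots\diamond V_n\to W$ in $\mathsf{C}$ is $(\mathcal{T},\varphi)$-multilinear if $w\circ\mathcal{T}f\circ\varphi=f\circ(v_1\diamond\cdots\diamond v_n)$, with $\varphi$ the iterated structure map; it is universal if every multilinear map with the same domain sequence factors uniquely as a morphism of algebras after it. $V_1\diamond^{\varphi}\cdots\diamond^{\varphi}V_n$ is the codomain of the universal $(\mathcal{T},\varphi)$-multilinear map $v_{V_1,\dots,V_n}$. Similarly $V_1\star^{\gamma}\cdots\star^{\gamma}V_n$ is the codomain of the universal $(\mathcal{T},\gamma)$-multilinear map $u_{V_1,\dots,V_n}:V_1\star\cdots\star V_n\to V_1\star^\gamma\cdots\star^\gamma V_n$ (defined using $\star$ and $\gamma$). Under the hypotheses these exist and define two monoidal structures on $\mathsf{C}^{\mathcal{T}}$ with units the free algebras $\mathcal{T}I$ and $\mathcal{T}J$. The maps $\varphi_{X,Y}$ and $\gamma_{X,Y}$ are universal bilinear for free algebras, so they induce isomorphisms of algebras $\bar\varphi:\mathcal{F}^{\mathcal{T}}X\diamond^{\varphi}\mathcal{F}^{\mathcal{T}}Y\to\mathcal{F}^{\mathcal{T}}(X\diamond Y)$ and $\bar\gamma:\mathcal{F}^{\mathcal{T}}X\star^{\gamma}\mathcal{F}^{\mathcal{T}}Y\to\mathcal{F}^{\mathcal{T}}(X\star Y)$, where $\mathcal{F}^{\mathcal{T}}X=(\mathcal{T}X,\mu_X)$. **Interchange law on $\mathsf{C}^{\mathcal{T}}$.** $\zeta^{\mathcal{T}}_{A,B,C,D}:(A\star^{\gamma}B)\diamond^{\varphi}(C\star^{\gamma}D)\to(A\diamond^{\varphi}C)\star^{\gamma}(B\diamond^{\varphi}D)$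 is the unique algebra morphism with $\zeta^{\mathcal{T}}\circ v\circ(u\diamond u)=u\circ(v\star v)\circ\zeta$. The unit maps are obtained by applying $\mathcal{T}$ to the unit maps of $\mathsf{C}$ (using the isomorphisms $\bar\gamma:\mathcal{T}I\star^{\gamma}\mathcal{T}I\cong\mathcal{T}(I\star I)$ and $\bar\varphi:\mathcal{T}J\diamond^{\varphi}\mathcal{T}J\cong\mathcal{T}(J\diamond J)$). **Double strong monoidal functor.** A functor $F$ between duoidal categories which is strong monoidal with respect to both pairs of monoidal structures, with structure isomorphisms $\bar\varphi$ and $\bar\gamma$, such that $F\zeta\circ\bar\varphi\circ(\bar\gamma\diamond\bar\gamma)=\bar\gamma\circ(\bar\varphi\star\bar\varphi)\circ\zeta$ and the analogous compatibilities with the three unit maps hold (the same four equations as for a double monoidal monad, with target operations and structure maps those of the target category). For $\mathcal{F}^{\mathcal{T}}$ the structure isomorphisms are the $\bar\varphi$, $\bar\gamma$ above, and identities on units. *)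

(* Defs.v *)
(* Categories are plain records over Stdlib; morphisms are compared with [=]. *)
From Stdlib Require Import List ProofIrrelevance.
Import ListNotations.
Set Implicit Arguments.
Unset Strict Implicit.
Unset Printing Implicit Defensive.

Record Category := {
  Ob :> Type;
  Hom : Ob -> Ob -> Type;
  idm : forall A, Hom A A;
  comp : forall A B C, Hom B C -> Hom A B -> Hom A C;
  comp_idl : forall A B (f : Hom A B), comp (idm B) f = f;
  comp_idr : forall A B (f : Hom A B), comp f (idm A) = f;
  comp_assoc : forall A B C D (h : Hom C D) (g : Hom B C) (f : Hom A B),
    comp h (comp g f) = comp (comp h g) f
}.
Arguments Hom {c} _ _.
Arguments idm {c} _.
Arguments comp {c A B C} _ _.
Notation "g ∘ f" := (comp g f) (at level 40, left associativity).

Definition is_iso {C : Category} {A B : C} (f : Hom A B) : Prop :=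
  exists g : Hom B A, g ∘ f = idm A /\ f ∘ g = idm B.

Record Functor (C D : Category) := {
  fobj :> C -> D;
  fmap : forall A B, Hom A B -> Hom (fobj A) (fobj B);
  fmap_id : forall A, fmap (idm A) = idm (fobj A);
  fmap_comp : forall A B E (g : Hom B E) (f : Hom A B),
    fmap (g ∘ f) = fmap g ∘ fmap f
}.
Arguments fmap {C D} _ {A B} _.

Definition reflexive_pair {C : Category} {X Y : C} (f g : Hom X Y) : Prop :=
  exists s : Hom Y X, f ∘ s = idm Y /\ g ∘ s = idm Y.

Definition is_coequalizer {C : Category} {X Y Z : C}
    (f g : Hom X Y) (q : Hom Y Z) : Prop :=
  q ∘ f = q ∘ g /\
  forall W (h : Hom Y W), h ∘ f = h ∘ g -> exists! k : Hom Z W, k ∘ q = h.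

Definition has_reflexive_coequalizers (C : Category) : Prop :=
  forall (X Y : C) (f g : Hom X Y), reflexive_pair f g ->
  exists (Z : C) (q : Hom Y Z), is_coequalizer f g q.

Definition functor_preserves_rcoeq {C D : Category} (F : Functor C D) : Prop :=
  forall (X Y Z : C) (f g : Hom X Y) (q : Hom Y Z),
  reflexive_pair f g -> is_coequalizer f g q ->
  is_coequalizer (fmap F f) (fmap F g) (fmap F q).

(* The tensor product of objects and the unit are parameters, so that one can
   speak of a monoidal structure having a prescribed tensor product and unit. *)
Record Monoidal (C : Category) (ten : C -> C -> C) (I : C) := {
  tenm : forall A A' B B' : C, Hom A A' -> Hom B B' -> Hom (ten A B) (ten A' B');
  tenm_id : forall A B, tenm (idm A) (idm B) = idm (ten A B);
  tenm_comp : forall A A' A'' B B' B'' (f' : Hom A' A'') (f : Hom A A')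
      (g' : Hom B' B'') (g : Hom B B'),
    tenm (f' ∘ f) (g' ∘ g) = tenm f' g' ∘ tenm f g;
  assoc : forall A B D : C, Hom (ten (ten A B) D) (ten A (ten B D));
  assoc_iso : forall A B D, is_iso (assoc A B D);
  assoc_nat : forall A A' B B' D D' (f : Hom A A') (g : Hom B B') (h : Hom D D'),
    assoc A' B' D' ∘ tenm (tenm f g) h = tenm f (tenm g h) ∘ assoc A B D;
  lunit : forall A : C, Hom (ten I A) A;
  lunit_iso : forall A, is_iso (lunit A);
  lunit_nat : forall A A' (f : Hom A A'),
    lunit A' ∘ tenm (idm I) f = f ∘ lunit A;
  runit : forall A : C, Hom (ten A I) A;
  runit_iso : forall A, is_iso (runit A);
  runit_nat : forall A A' (f : Hom A A'),
    runit A' ∘ tenm f (idm I) = f ∘ runit A;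
  triangle : forall A B,
    tenm (idm A) (lunit B) ∘ assoc A I B = tenm (runit A) (idm B);
  pentagon : forall A B D E,
    assoc A B (ten D E) ∘ assoc (ten A B) D E
    = tenm (idm A) (assoc B D E) ∘ assoc A (ten B D) E ∘ tenm (assoc A B D) (idm E)
}.
Arguments tenm {C ten I} m {A A' B B'} _ _.
Arguments assoc {C ten I} m A B D.
Arguments lunit {C ten I} m A.
Arguments runit {C ten I} m A.
Notation "f ⊗[ M ] g" := (tenm M f g) (at level 38, no associativity).

(* Preservation by a tensor product is preservation in each variable. *)
Definition tensor_preserves_rcoeq {C : Category} {ten : C -> C -> C} {I : C}
    (M : Monoidal ten I) : Prop :=
  forall (A X Y Z : C) (f g : Hom X Y) (q : Hom Y Z),
  reflexive_pair f g -> is_coequalizer f g q ->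
  is_coequalizer (idm A ⊗[M] f) (idm A ⊗[M] g) (idm A ⊗[M] q) /\
  is_coequalizer (f ⊗[M] idm A) (g ⊗[M] idm A) (q ⊗[M] idm A).

Record LaxMonoidal (C D : Category)
    (tenC : C -> C -> C) (IC : C) (M : Monoidal tenC IC)
    (tenD : D -> D -> D) (ID : D) (N : Monoidal tenD ID) (F : Functor C D) := {
  lax2 : forall A B : C, Hom (tenD (F A) (F B)) (F (tenC A B));
  lax0 : Hom ID (F IC);
  lax2_nat : forall A A' B B' (f : Hom A A') (g : Hom B B'),
    lax2 A' B' ∘ (fmap F f ⊗[N] fmap F g) = fmap F (f ⊗[M] g) ∘ lax2 A B;
  lax_assoc : forall A B E,
    fmap F (assoc M A B E) ∘ lax2 (tenC A B) E ∘ (lax2 A B ⊗[N] idm (F E))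
    = lax2 A (tenC B E) ∘ (idm (F A) ⊗[N] lax2 B E) ∘ assoc N (F A) (F B) (F E);
  lax_lunit : forall A,
    fmap F (lunit M A) ∘ lax2 IC A ∘ (lax0 ⊗[N] idm (F A)) = lunit N (F A);
  lax_runit : forall A,
    fmap F (runit M A) ∘ lax2 A IC ∘ (idm (F A) ⊗[N] lax0) = runit N (F A)
}.
Arguments lax2 {C D tenC IC M tenD ID N F} l A B.
Arguments lax0 {C D tenC IC M tenD ID N F} l.

Definition is_strong {C D : Category}
    {tenC : C -> C -> C} {IC : C} {M : Monoidal tenC IC}
    {tenD : D -> D -> D} {ID : D} {N : Monoidal tenD ID} {F : Functor C D}
    (L : LaxMonoidal M N F) : Prop :=
  (forall A B, is_iso (lax2 L A B)) /\ is_iso (lax0 L).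

Record Duoidal (C : Category)
    (dia : C -> C -> C) (I : C) (star : C -> C -> C) (J : C) := {
  diam : Monoidal dia I;
  starm : Monoidal star J;
  zeta : forall A B X Y : C,
    Hom (dia (star A B) (star X Y)) (star (dia A X) (dia B Y));
  delta : Hom I (star I I);
  theta : Hom (dia J J) J;
  zeta0 : Hom I J;
  zeta_nat : forall A A' B B' X X' Y Y'
      (a : Hom A A') (b : Hom B B') (x : Hom X X') (y : Hom Y Y'),
    zeta A' B' X' Y' ∘ ((a ⊗[starm] b) ⊗[diam] (x ⊗[starm] y))
    = ((a ⊗[diam] x) ⊗[starm] (b ⊗[diam] y)) ∘ zeta A B X Y;
  (* (A⋆X)⋄(B⋆Y)⋄(E⋆Z) → (A⋄B⋄E)⋆(X⋄Y⋄Z) *)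
  zeta_dia_assoc : forall A X B Y E Z,
    (assoc diam A B E ⊗[starm] assoc diam X Y Z)
      ∘ zeta (dia A B) (dia X Y) E Z ∘ (zeta A X B Y ⊗[diam] idm (star E Z))
    = zeta A X (dia B E) (dia Y Z) ∘ (idm (star A X) ⊗[diam] zeta B Y E Z)
      ∘ assoc diam (star A X) (star B Y) (star E Z);
  (* (A⋆B⋆E)⋄(X⋆Y⋆Z) → (A⋄X)⋆(B⋄Y)⋆(E⋄Z) *)
  zeta_star_assoc : forall A B E X Y Z,
    assoc starm (dia A X) (dia B Y) (dia E Z)
      ∘ (zeta A B X Y ⊗[starm] idm (dia E Z)) ∘ zeta (star A B) E (star X Y) Z
    = (idm (dia A X) ⊗[starm] zeta B E Y Z) ∘ zeta A (star B E) X (star Y Z)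
      ∘ (assoc starm A B E ⊗[diam] assoc starm X Y Z);
  zeta_delta_l : forall A B,
    (lunit diam A ⊗[starm] lunit diam B) ∘ zeta I I A B
      ∘ (delta ⊗[diam] idm (star A B))
    = lunit diam (star A B);
  zeta_delta_r : forall A B,
    (runit diam A ⊗[starm] runit diam B) ∘ zeta A B I I
      ∘ (idm (star A B) ⊗[diam] delta)
    = runit diam (star A B);
  zeta_theta_l : forall A B,
    lunit starm (dia A B) ∘ (theta ⊗[starm] idm (dia A B)) ∘ zeta J A J B
    = lunit starm A ⊗[diam] lunit starm B;
  zeta_theta_r : forall A B,
    runit starm (dia A B) ∘ (idm (dia A B) ⊗[starm] theta) ∘ zeta A J B J
    = runit starm A ⊗[diam] runit starm B;
  theta_assoc :
    theta ∘ (theta ⊗[diam] idm J) = theta ∘ (idm J ⊗[diam] theta) ∘ assoc diam J J J;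
  theta_unit_l : theta ∘ (zeta0 ⊗[diam] idm J) = lunit diam J;
  theta_unit_r : theta ∘ (idm J ⊗[diam] zeta0) = runit diam J;
  delta_coassoc :
    assoc starm I I I ∘ (delta ⊗[starm] idm I) ∘ delta
    = (idm I ⊗[starm] delta) ∘ delta;
  delta_counit_l : lunit starm I ∘ (zeta0 ⊗[starm] idm I) ∘ delta = idm I;
  delta_counit_r : runit starm I ∘ (idm I ⊗[starm] zeta0) ∘ delta = idm I
}.
Arguments zeta {C dia I star J} d A B X Y.

(* The four equations shared by double monoidal monads and double (strong)
   monoidal functors. *)
Record double_monoidal (C D : Category)
    (diaC : C -> C -> C) (IC : C) (starC : C -> C -> C) (JC : C)
    (dC : Duoidal diaC IC starC JC)
    (diaD : D -> D -> D) (ID : D) (starD : D -> D -> D) (JD : D)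
    (dD : Duoidal diaD ID starD JD)
    (F : Functor C D)
    (phi : LaxMonoidal (diam dC) (diam dD) F)
    (gamma : LaxMonoidal (starm dC) (starm dD) F) : Prop := {
  double_zeta : forall A B X Y,
    fmap F (zeta dC A B X Y) ∘ lax2 phi (starC A B) (starC X Y)
      ∘ (lax2 gamma A B ⊗[diam dD] lax2 gamma X Y)
    = lax2 gamma (diaC A X) (diaC B Y)
      ∘ (lax2 phi A X ⊗[starm dD] lax2 phi B Y)
      ∘ zeta dD (F A) (F B) (F X) (F Y);
  double_delta :
    lax2 gamma IC IC ∘ (lax0 phi ⊗[starm dD] lax0 phi) ∘ delta dD
    = fmap F (delta dC) ∘ lax0 phi;
  double_theta :
    lax0 gamma ∘ theta dD
    = fmap F (theta dC) ∘ lax2 phi JC JC ∘ (lax0 gamma ⊗[diam dD] lax0 gamma);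
  double_zeta0 :
    lax0 gamma ∘ zeta0 dD = fmap F (zeta0 dC) ∘ lax0 phi
}.

Record Monad (C : Category) := {
  mfun :> Functor C C;
  eta : forall A : C, Hom A (mfun A);
  mu : forall A : C, Hom (mfun (mfun A)) (mfun A);
  eta_nat : forall A B (f : Hom A B), fmap mfun f ∘ eta A = eta B ∘ f;
  mu_nat : forall A B (f : Hom A B),
    fmap mfun f ∘ mu A = mu B ∘ fmap mfun (fmap mfun f);
  mu_eta_l : forall A, mu A ∘ eta (mfun A) = idm (mfun A);
  mu_eta_r : forall A, mu A ∘ fmap mfun (eta A) = idm (mfun A);
  mu_assoc : forall A, mu A ∘ mu (mfun A) = mu A ∘ fmap mfun (mu A)
}.

Record Algebra (C : Category) (T : Monad C) := {
  carrier : C;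
  action : Hom (T carrier) carrier;
  action_eta : action ∘ eta T carrier = idm carrier;
  action_mu : action ∘ mu T carrier = action ∘ fmap T action
}.

Record AlgHom (C : Category) (T : Monad C) (A B : Algebra T) := {
  und : Hom (carrier A) (carrier B);
  und_action : action B ∘ fmap T und = und ∘ action A
}.

Section EilenbergMoore.
Context {C : Category} (T : Monad C).

Lemma AlgHom_eq (A B : Algebra T) (f g : AlgHom A B) : und f = und g -> f = g.
Proof.
  destruct f as [f Hf], g as [g Hg]; simpl; intros <-.
  now rewrite (proof_irrelevance _ Hf Hg).
Qed.

Lemma alg_id_action (A : Algebra T) :
  action A ∘ fmap T (idm (carrier A)) = idm (carrier A) ∘ action A.
Proof. now rewrite fmap_id, comp_idl, comp_idr. Qed.

Lemma alg_comp_action (A B E : Algebra T) (g : AlgHom B E) (f : AlgHom A B) :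
  action E ∘ fmap T (und g ∘ und f) = und g ∘ und f ∘ action A.
Proof.
  now rewrite fmap_comp, comp_assoc, und_action, <- comp_assoc, und_action,
    comp_assoc.
Qed.

Definition EM : Category.
Proof.
  refine {| Ob := Algebra T;
            Hom := @AlgHom C T;
            idm := fun A => {| und := idm (carrier A);
                               und_action := alg_id_action A |};
            comp := fun A B E g f => {| und := und g ∘ und f;
                                        und_action := alg_comp_action g f |} |}.
  - intros; apply AlgHom_eq, comp_idl.
  - intros; apply AlgHom_eq, comp_idr.
  - intros; apply AlgHom_eq, comp_assoc.
Defined.

Definition free_alg (X : C) : EM :=
  {| carrier := T X; action := mu T X;
     action_eta := mu_eta_l T X; action_mu := mu_assoc T X |}.

Definition Free : Functor C EM.
Proof.
  refine {| fobj := free_alg;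
            fmap := fun X Y f => {| und := fmap T f : Hom (carrier (free_alg X))
                                                          (carrier (free_alg Y));
                                    und_action := eq_sym (mu_nat T f) |}
                    : @Hom EM (free_alg X) (free_alg Y) |}.
  - intros; apply AlgHom_eq, fmap_id.
  - intros; apply AlgHom_eq, fmap_comp.
Defined.
End EilenbergMoore.

(* A lax monoidal structure on the endofunctor for which [eta] and [mu] are
   monoidal transformations (from Id and from T∘T). *)
Record MonoidalMonad (C : Category) (ten : C -> C -> C) (I : C)
    (M : Monoidal ten I) (T : Monad C) := {
  mlax :> LaxMonoidal M M T;
  eta_lax2 : forall A B, lax2 mlax A B ∘ (eta T A ⊗[M] eta T B) = eta T (ten A B);
  eta_lax0 : lax0 mlax = eta T I;
  mu_lax2 : forall A B,
    mu T (ten A B) ∘ (fmap T (lax2 mlax A B) ∘ lax2 mlax (T A) (T B))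
    = lax2 mlax A B ∘ (mu T A ⊗[M] mu T B);
  mu_lax0 : mu T I ∘ (fmap T (lax0 mlax) ∘ lax0 mlax) = lax0 mlax
}.

Section Multilinear.
Context {C : Category} {ten : C -> C -> C} {I : C} {M : Monoidal ten I}
        {T : Monad C} (phi : MonoidalMonad M T).

(* [ten_list [A1; ..; An]] is A1 ⊗ (A2 ⊗ (.. ⊗ An)), without a trailing unit:
   [ten_list [A; B]] reduces to [ten A B]. *)
Fixpoint ten_list (l : list C) : C :=
  match l with
  | [] => I
  | A :: l' => match l' with [] => A | _ :: _ => ten A (ten_list l') end
  end.

(* The iterated structure map T A1 ⊗ .. ⊗ T An → T (A1 ⊗ .. ⊗ An). *)
Fixpoint lax_list (l : list C) : Hom (ten_list (map T l)) (T (ten_list l)) :=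
  match l with
  | [] => lax0 phi
  | A :: l' =>
      match l' return Hom (ten_list (map T l')) (T (ten_list l')) ->
                      Hom (ten_list (map T (A :: l'))) (T (ten_list (A :: l')))
      with
      | [] => fun _ => idm (T A)
      | B :: l'' => fun r => lax2 phi A (ten_list (B :: l'')) ∘ (idm (T A) ⊗[M] r)
      end (lax_list l')
  end.

Definition ten_alg (l : list (Algebra T)) : C := ten_list (map (@carrier C T) l).

Fixpoint act_list (l : list (Algebra T)) :
    Hom (ten_list (map T (map (@carrier C T) l))) (ten_alg l) :=
  match l with
  | [] => idm I
  | V :: l' =>
      match l' return Hom (ten_list (map T (map (@carrier C T) l'))) (ten_alg l') ->
                      Hom (ten_list (map T (map (@carrier C T) (V :: l'))))
                          (ten_alg (V :: l'))
      with
      | [] => fun _ => action V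
      | _ :: _ => fun r => action V ⊗[M] r
      end (act_list l')
  end.

Definition multilinear (l : list (Algebra T)) (W : Algebra T)
    (f : Hom (ten_alg l) (carrier W)) : Prop :=
  action W ∘ fmap T f ∘ lax_list (map (@carrier C T) l) = f ∘ act_list l.

Record UniversalMultilinear (l : list (Algebra T)) := {
  um_obj : EM T;
  um_map : Hom (ten_alg l) (carrier um_obj);
  um_multilinear : multilinear um_map;
  um_universal : forall (W : EM T) (f : Hom (ten_alg l) (carrier W)),
    multilinear f -> exists! h : Hom um_obj W, und h ∘ um_map = f
}.

Definition UniversalBilinear : Type :=
  forall A B : EM T, UniversalMultilinear [A; B].

Context (v : UniversalBilinear).

Definition tenT (A B : EM T) : EM T := um_obj (v A B).

Definition univ (A B : EM T) : Hom (ten (carrier A) (carrier B)) (carrier (tenT A B)) :=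
  um_map (v A B).

(* The monoidal structure on [EM T] induced by the universal property: its unit
   is the free algebra on I, the codomain of the universal 0-ary map
   [lax0 phi] : I → T I. *)
Record induced_monoidal (N : Monoidal tenT (Free T I)) : Prop := {
  ind_tenm : forall (A A' B B' : EM T) (f : Hom A A') (g : Hom B B'),
    unique (fun h : Hom (tenT A B) (tenT A' B') =>
              und h ∘ univ A B = univ A' B' ∘ (und f ⊗[M] und g))
           (f ⊗[N] g);
  ind_assoc : forall A B D : EM T,
    unique (fun h : Hom (tenT (tenT A B) D) (tenT A (tenT B D)) =>
              und h ∘ univ (tenT A B) D ∘ (univ A B ⊗[M] idm (carrier D))
              = univ A (tenT B D) ∘ (idm (carrier A) ⊗[M] univ B D)
                ∘ assoc M (carrier A) (carrier B) (carrier D))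
           (assoc N A B D);
  ind_lunit : forall A : EM T,
    unique (fun h : Hom (tenT (Free T I) A) A =>
              und h ∘ univ (Free T I) A ∘ (lax0 phi ⊗[M] idm (carrier A))
              = lunit M (carrier A))
           (lunit N A);
  ind_runit : forall A : EM T,
    unique (fun h : Hom (tenT A (Free T I)) A =>
              und h ∘ univ A (Free T I) ∘ (idm (carrier A) ⊗[M] lax0 phi)
              = runit M (carrier A))
           (runit N A)
}.
End Multilinear.

Record DoubleMonoidalMonad (C : Category)
    (dia : C -> C -> C) (I : C) (star : C -> C -> C) (J : C)
    (D : Duoidal dia I star J) := {
  dmonad :> Monad C;
  dphi : MonoidalMonad (diam D) dmonad;
  dgamma : MonoidalMonad (starm D) dmonad;
  ddouble : double_monoidal dphi dgamma
}.

Section DuoidalEM.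
Context {C : Category} {dia : C -> C -> C} {I : C} {star : C -> C -> C} {J : C}
        {D : Duoidal dia I star J} (T : DoubleMonoidalMonad D)
        (v : UniversalBilinear (dphi T)) (u : UniversalBilinear (dgamma T)).

Definition is_induced_zeta (A B X Y : EM T)
    (z : Hom (tenT v (tenT u A B) (tenT u X Y)) (tenT u (tenT v A X) (tenT v B Y))) :
    Prop :=
  unique (fun h : Hom (tenT v (tenT u A B) (tenT u X Y))
                      (tenT u (tenT v A X) (tenT v B Y)) =>
            und h ∘ univ v (tenT u A B) (tenT u X Y)
                  ∘ (univ u A B ⊗[diam D] univ u X Y)
            = univ u (tenT v A X) (tenT v B Y)
              ∘ (univ v A X ⊗[starm D] univ v B Y)
              ∘ zeta D (carrier A) (carrier B) (carrier X) (carrier Y))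
         z.

(* [phib] and [gammab] are the comparison maps of the free algebra functor,
   induced by [phi] and [gamma]; [delta] on [EM T] is gammab⁻¹ ∘ T delta. *)
Record induced_duoidal
    (DT : Duoidal (tenT v) (Free T I) (tenT u) (Free T J))
    (phib : LaxMonoidal (diam D) (diam DT) (Free T))
    (gammab : LaxMonoidal (starm D) (starm DT) (Free T)) : Prop := {
  ind_diam : induced_monoidal (diam DT);
  ind_starm : induced_monoidal (starm DT);
  ind_phib : forall X Y : C,
    unique (fun h : Hom (tenT v (Free T X) (Free T Y)) (Free T (dia X Y)) =>
              und h ∘ univ v (Free T X) (Free T Y) = lax2 (dphi T) X Y)
           (lax2 phib X Y);
  ind_phib0 : lax0 phib = idm (Free T I);
  ind_gammab : forall X Y : C,
    unique (fun h : Hom (tenT u (Free T X) (Free T Y)) (Free T (star X Y)) =>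
              und h ∘ univ u (Free T X) (Free T Y) = lax2 (dgamma T) X Y)
           (lax2 gammab X Y);
  ind_gammab0 : lax0 gammab = idm (Free T J);
  ind_zeta : forall A B X Y : EM T, is_induced_zeta (zeta DT A B X Y);
  ind_delta : lax2 gammab I I ∘ delta DT = fmap (Free T) (delta D);
  ind_theta : theta DT = fmap (Free T) (theta D) ∘ lax2 phib J J;
  ind_zeta0 : zeta0 DT = fmap (Free T) (zeta0 D)
}.
End DuoidalEM.

(* Main.v *)
(** A tensor product of algebras represents multilinear maps, so the composite of
    universal maps [V₁ ⊗ .. ⊗ Vₙ → (.. (V₁ ⊗^φ V₂) ..)] should again be universal.
    It is: a universal map [u : Y → Q] exhibits [Q] as a reflexive coequalizer of
    free algebras on [T Y], and reflexive coequalizers are preserved jointly by the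
    tensor product, so bilinear maps out of [Q₁ × Q₂] amount to suitably linear maps
    out of [Y₁ ⊗ Y₂].  Hence each structure map of [C^T] can be characterised as the
    unique morphism lying over the corresponding structure map of [C] along such
    universal maps; two morphisms lying over equal maps are equal, and each axiom in
    [C^T] follows from the same axiom in [C]. *)
Require Import Defs.
From Stdlib Require Import List ssreflect IndefiniteDescription.
Import ListNotations.
Set Implicit Arguments.
Unset Strict Implicit.
Unset Printing Implicit Defensive.

(** * Coequalizers under isomorphisms, functors and tensor products *)

Lemma comp_pre (C : Category) (X Y Z : C) (g : Hom Y Z) (f : Hom X Y) (k : Hom X Z)
    (W : C) (x : Hom W X) : g ∘ f = k -> g ∘ (f ∘ x) = k ∘ x.
Proof. by move=> <-; rewrite comp_assoc. Qed.

Lemma coequalizer_epi (C : Category) (X Y Z : C) (f g : Hom X Y) (q : Hom Y Z)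
    (W : C) (h k : Hom Z W) :
  is_coequalizer f g q -> h ∘ q = k ∘ q -> h = k.
Proof.
  move=> [Hq Hu] Hhk.
  have [l [_ Hl]] : exists! l, l ∘ q = k ∘ q.
    by apply: Hu; rewrite -!comp_assoc Hq.
  by rewrite -(Hl _ Hhk) (Hl k).
Qed.

Lemma coequalizer_iso (C : Category) (X Y Z Z' : C) (f g : Hom X Y) (q : Hom Y Z)
    (k : Hom Z Z') :
  is_coequalizer f g q -> is_iso k -> is_coequalizer f g (k ∘ q).
Proof.
  move=> [Hq Hu] [k' [Hk'k Hkk']]; split; first by rewrite -!comp_assoc Hq.
  move=> W h /Hu [l [Hl Hun]]; exists (l ∘ k'); split.
    by rewrite -comp_assoc (comp_pre _ Hk'k) comp_idl.
  move=> m Hm; rewrite (Hun (m ∘ k)); first by rewrite -comp_assoc.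
  by rewrite -comp_assoc Hkk' comp_idr.
Qed.

Lemma fmap_reflexive (C D : Category) (F : Functor C D) (X Y : C) (f g : Hom X Y) :
  reflexive_pair f g -> reflexive_pair (fmap F f) (fmap F g).
Proof.
  by move=> [s [Hf Hg]]; exists (fmap F s); rewrite -!fmap_comp Hf Hg !fmap_id.
Qed.

(** Reflexivity splits the joint condition: precomposing with the common section in one factor gives
    a condition in the other factor alone. So [h] descends first along [q ⊗ idm Y'], then along
    [idm Z ⊗ q']. *)
Lemma tenm_coequalizer (C : Category) (ten : C -> C -> C) (I : C) (M : Monoidal ten I)
    (X Y Z X' Y' Z' : C) (f g : Hom X Y) (q : Hom Y Z) (f' g' : Hom X' Y') (q' : Hom Y' Z') :
  tensor_preserves_rcoeq M ->
  reflexive_pair f g -> is_coequalizer f g q ->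
  reflexive_pair f' g' -> is_coequalizer f' g' q' ->
  is_coequalizer (f ⊗[M] f') (g ⊗[M] g') (q ⊗[M] q').
Proof.
  move=> HM Hr Hq Hr' Hq'.
  have [[s [Hfs Hgs]] [s' [Hfs' Hgs']]] := (Hr, Hr').
  have [_ Hl] := HM Y' _ _ _ _ _ _ Hr Hq.
  have [_ Hlx] := HM X' _ _ _ _ _ _ Hr Hq.
  have [Hrz _] := HM Z _ _ _ _ _ _ Hr' Hq'.
  have Eq (A B : C) (k : Hom A B) : q ⊗[M] k = (idm Z ⊗[M] k) ∘ (q ⊗[M] idm A).
    by rewrite -tenm_comp comp_idl comp_idr.
  split; first by rewrite -!tenm_comp; case: Hq => ->; case: Hq' => ->.
  move=> W h Hh.
  have H1 : h ∘ (f ⊗[M] idm Y') = h ∘ (g ⊗[M] idm Y').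
    rewrite -{1}Hfs' -Hgs' -(comp_idr f) -(comp_idr g) !tenm_comp.
    by rewrite !comp_assoc Hh.
  have H2 : h ∘ (idm Y ⊗[M] f') = h ∘ (idm Y ⊗[M] g').
    rewrite -{1}Hfs -Hgs -(comp_idr f') -(comp_idr g') !tenm_comp.
    by rewrite !comp_assoc Hh.
  have [h1 [Hh1 _]] := (proj2 Hl) _ _ H1.
  (* The condition for the second descent is tested after [q ⊗ idm X'], which is epi because
     tensoring with [X'] preserves the coequalizer [q]. *)
  have H3 : h1 ∘ (idm Z ⊗[M] f') = h1 ∘ (idm Z ⊗[M] g').
    apply: (coequalizer_epi Hlx).
    rewrite -!comp_assoc -!tenm_comp !comp_idl !comp_idr.
    have E (k : Hom X' Y') : q ⊗[M] k = (q ⊗[M] idm Y') ∘ (idm Y ⊗[M] k).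
      by rewrite -tenm_comp comp_idl comp_idr.
    by rewrite !E !comp_assoc Hh1.
  have [k [Hk _]] := (proj2 Hrz) _ _ H3.
  exists k; split; first by rewrite Eq comp_assoc Hk.
  move=> m Hm; apply: (coequalizer_epi Hrz); apply: (coequalizer_epi Hl).
  by rewrite Hk Hh1 -comp_assoc -Eq.
Qed.

Lemma unique_exists_iff (A : Type) (P Q : A -> Prop) :
  (forall x, P x <-> Q x) -> (exists! x, P x) -> exists! x, Q x.
Proof.
  move=> H [x [Hx Hu]]; exists x; split; first exact/H.
  by move=> y /H; exact: Hu.
Qed.

(** * Linear maps, universal linear maps, and morphisms lying over maps of [C] *)

Section LinearMaps.
Context {C : Category} (T : Monad C).

(* A notion of linearity for maps out of [Y]: [f] is linear when
   [w ∘ T f ∘ lin_lax = f ∘ lin_act].  For Y = V₁ ⊗ .. ⊗ Vₙ the domain is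
   T V₁ ⊗ .. ⊗ T Vₙ; the section makes the pair presenting the universal linear
   map reflexive. *)
Record LinData (Y : C) := {
  lin_dom : C;
  lin_act : Hom lin_dom Y;
  lin_lax : Hom lin_dom (T Y);
  lin_sec : Hom Y lin_dom;
  lin_act_sec : lin_act ∘ lin_sec = idm Y;
  lin_lax_sec : lin_lax ∘ lin_sec = eta T Y
}.

Definition linear (Y : C) (E : LinData Y) (W : EM T) (f : Hom Y (carrier W)) : Prop :=
  action W ∘ fmap T f ∘ lin_lax E = f ∘ lin_act E.

Definition universal (Y : C) (E : LinData Y) (Q : EM T) (u : Hom Y (carrier Q)) : Prop :=
  linear E u /\
  forall (W : EM T) (f : Hom Y (carrier W)), linear E f ->
    exists! h : Hom Q W, und h ∘ u = f.

(** Forgets which presentation makes [u] universal: comparing two morphisms out of [Q] needs only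
    that some presentation does. *)
Definition dense (Y : C) (Q : EM T) (u : Hom Y (carrier Q)) : Prop :=
  exists E : LinData Y, universal E u.

(** The relation that carries equations from [C] to [EM T]: it is closed under composition and
    tensoring, and for dense [u] the map [m] determines [h]. *)
Definition over (Y Y' : C) (Q Q' : EM T) (u : Hom Y (carrier Q)) (u' : Hom Y' (carrier Q'))
    (m : Hom Y Y') (h : Hom Q Q') : Prop :=
  und h ∘ u = u' ∘ m.

(** A morphism of presentations; its purpose is that precomposition with [m] preserves linearity. *)
Definition lin_mor (Y Y' : C) (E : LinData Y) (E' : LinData Y') (m : Hom Y Y')
    (m' : Hom (lin_dom E) (lin_dom E')) : Prop :=
  m ∘ lin_act E = lin_act E' ∘ m' /\ fmap T m ∘ lin_lax E = lin_lax E' ∘ m'.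

Definition free_gen (X : C) : Hom X (carrier (Free T X)) := eta T X.

(** The transpose of [f] under the free-forgetful adjunction. *)
Definition sharp (Y : C) (W : EM T) (f : Hom Y (carrier W)) : Hom (T Y) (carrier W) :=
  action W ∘ fmap T f.

Lemma sharp_eta (Y : C) (W : EM T) (f : Hom Y (carrier W)) : sharp f ∘ eta T Y = f.
Proof. by rewrite /sharp -comp_assoc eta_nat comp_assoc action_eta comp_idl. Qed.

Lemma sharp_comp (X Y : C) (W : EM T) (f : Hom Y (carrier W)) (g : Hom X Y) :
  sharp f ∘ fmap T g = sharp (f ∘ g).
Proof. by rewrite /sharp fmap_comp comp_assoc. Qed.

Lemma und_sharp (Y : C) (Q W : EM T) (h : Hom Q W) (f : Hom Y (carrier Q)) :
  und h ∘ sharp f = sharp (und h ∘ f).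
Proof. by rewrite /sharp comp_assoc -und_action fmap_comp comp_assoc. Qed.

Lemma sharp_mu (Y : C) (W : EM T) (f : Hom Y (carrier W)) :
  sharp f ∘ mu T Y = sharp (sharp f).
Proof.
  by rewrite /sharp -comp_assoc mu_nat comp_assoc action_mu fmap_comp comp_assoc.
Qed.

(** Transposition is injective by [sharp_eta], so the linearity equation on [lin_dom E] may be
    tested on the free algebra over it. There it says that [sharp f] coequalizes a parallel pair of
    morphisms of free algebras. *)
Lemma linearE (Y : C) (E : LinData Y) (W : EM T) (f : Hom Y (carrier W)) :
  linear E f <-> sharp f ∘ fmap T (lin_act E) = sharp f ∘ (mu T Y ∘ fmap T (lin_lax E)).
Proof.
  rewrite comp_assoc sharp_mu !sharp_comp; split=> [-> // | H].
  rewrite /linear -/(sharp f) -(sharp_eta (f ∘ lin_act E)) H; by rewrite sharp_eta.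
Qed.

Lemma lin_reflexive (Y : C) (E : LinData Y) :
  reflexive_pair (fmap T (lin_act E)) (mu T Y ∘ fmap T (lin_lax E)).
Proof.
  exists (fmap T (lin_sec E)); rewrite -comp_assoc -!fmap_comp lin_act_sec lin_lax_sec.
  by rewrite fmap_id mu_eta_r.
Qed.

Lemma sharp_hom_action (Y : C) (W : EM T) (f : Hom Y (carrier W)) :
  action W ∘ fmap T (sharp f) = sharp f ∘ mu T Y.
Proof. by rewrite sharp_mu. Qed.

Definition sharp_hom (Y : C) (W : EM T) (f : Hom Y (carrier W)) : Hom (Free T Y) W :=
  {| und := sharp f : Hom (carrier (free_alg T Y)) _; und_action := sharp_hom_action f |}.

Lemma universal_dense (Y : C) (E : LinData Y) (Q : EM T) (u : Hom Y (carrier Q)) :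
  universal E u -> dense u.
Proof. by move=> Hu; exists E. Qed.

Lemma linear_postcomp (Y : C) (E : LinData Y) (Q W : EM T) (u : Hom Y (carrier Q))
    (k : Hom Q W) :
  linear E u -> linear E (und k ∘ u).
Proof.
  move=> Hu; rewrite /linear fmap_comp comp_assoc und_action -!comp_assoc.
  by rewrite (comp_assoc (action Q)) Hu comp_assoc.
Qed.

Lemma dense_inj (Y : C) (Q W : EM T) (u : Hom Y (carrier Q)) (h k : Hom Q W) :
  dense u -> und h ∘ u = und k ∘ u -> h = k.
Proof.
  move=> [E [Hlin Hu]] Hhk.
  have [l [_ Hl]] := Hu _ _ (linear_postcomp k Hlin).
  by rewrite -(Hl _ Hhk) (Hl k).
Qed.

Lemma over_eq (Y Y' : C) (Q Q' : EM T) (u : Hom Y (carrier Q)) (u' : Hom Y' (carrier Q'))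
    (m m' : Hom Y Y') (h h' : Hom Q Q') :
  dense u -> over u u' m h -> over u u' m' h' -> m = m' -> h = h'.
Proof. by move=> Hu Hh Hh' E; apply: (dense_inj Hu); rewrite Hh Hh' E. Qed.

Lemma over_id (Y : C) (Q : EM T) (u : Hom Y (carrier Q)) : over u u (idm Y) (idm Q).
Proof. by rewrite /over /= comp_idl comp_idr. Qed.

Lemma over_comp (Y Y' Y'' : C) (Q Q' Q'' : EM T) (u : Hom Y (carrier Q))
    (u' : Hom Y' (carrier Q')) (u'' : Hom Y'' (carrier Q''))
    (m : Hom Y Y') (m' : Hom Y' Y'') (h : Hom Q Q') (h' : Hom Q' Q'') :
  over u' u'' m' h' -> over u u' m h -> over u u'' (m' ∘ m) (h' ∘ h).
Proof. by rewrite /over /= -comp_assoc => H' ->; rewrite comp_assoc H' comp_assoc. Qed.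

Lemma over_und (Q Q' : EM T) (h : Hom Q Q') :
  over (idm (carrier Q)) (idm (carrier Q')) (und h) h.
Proof. by rewrite /over comp_idl comp_idr. Qed.

Lemma over_eta (X Y : C) (f : Hom X Y) : over (free_gen X) (free_gen Y) f (fmap (Free T) f).
Proof. exact: eta_nat. Qed.

Lemma lin_precomp (Y Y' : C) (E : LinData Y) (E' : LinData Y') (m : Hom Y Y')
    (m' : Hom (lin_dom E) (lin_dom E')) (W : EM T) (f : Hom Y' (carrier W)) :
  lin_mor m m' -> linear E' f -> linear E (f ∘ m).
Proof.
  move=> [Ha Hl] Hf; rewrite /linear fmap_comp -!comp_assoc Ha Hl !comp_assoc.
  by rewrite Hf.
Qed.

Lemma over_ext (Y Y' : C) (E : LinData Y) (E' : LinData Y') (m : Hom Y Y')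
    (m' : Hom (lin_dom E) (lin_dom E')) (Q Q' : EM T) (u : Hom Y (carrier Q))
    (u' : Hom Y' (carrier Q')) :
  lin_mor m m' -> universal E u -> linear E' u' -> exists! h : Hom Q Q', over u u' m h.
Proof. by move=> Hm [_ Hu] Hu'; apply: Hu (lin_precomp Hm Hu'). Qed.

Lemma lin_mor_inv (Y Y' : C) (E : LinData Y) (E' : LinData Y') (m : Hom Y Y')
    (m' : Hom (lin_dom E) (lin_dom E')) (n : Hom Y' Y) (n' : Hom (lin_dom E') (lin_dom E)) :
  lin_mor m m' -> n ∘ m = idm Y -> m' ∘ n' = idm (lin_dom E') -> lin_mor n n'.
Proof.
  move=> [Ha Hl] Hn Hn'; split.
    rewrite -(comp_idr (lin_act E')) -Hn' (comp_assoc _ m') -Ha.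
    by rewrite -!comp_assoc (comp_pre _ Hn) comp_idl.
  rewrite -(comp_idr (lin_lax E')) -Hn' (comp_assoc _ m') -Hl.
  by rewrite !comp_assoc -fmap_comp Hn fmap_id comp_idl.
Qed.

(** The inverses of [m] and [m'] again form a morphism of presentations and so induce a morphism
    back; both composites lie over identities, hence are identities by density. *)
Lemma over_iso (Y Y' : C) (E : LinData Y) (E' : LinData Y') (m : Hom Y Y')
    (m' : Hom (lin_dom E) (lin_dom E')) (Q Q' : EM T) (u : Hom Y (carrier Q))
    (u' : Hom Y' (carrier Q')) (h : Hom Q Q') :
  lin_mor m m' -> is_iso m -> is_iso m' ->
  universal E u -> universal E' u' -> over u u' m h -> is_iso h.
Proof.
  move=> Hm [n [Hn1 Hn2]] [n' [_ Hn'2]] Hu Hu' Hh.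
  have Hn := lin_mor_inv Hm Hn1 Hn'2.
  have [k [Hk _]] := over_ext Hn Hu' (proj1 Hu).
  exists k; split.
    exact: (over_eq (universal_dense Hu) (over_comp Hk Hh) (over_id u) Hn1).
  exact: (over_eq (universal_dense Hu') (over_comp Hh Hk) (over_id u') Hn2).
Qed.

(** Its linear maps are the algebra morphisms out of [A], so that the identity is universal. *)
Definition alg_lin (A : EM T) : LinData (carrier A).
Proof.
  refine {| lin_act := action A; lin_lax := idm (T (carrier A));
            lin_sec := eta T (carrier A) |}.
  - exact: action_eta.
  - exact: comp_idl.
Defined.

Lemma alg_lin_universal (A : EM T) : universal (alg_lin A) (idm (carrier A)).
Proof.
  split; first by rewrite /linear /= fmap_id !comp_idr comp_idl.
  move=> W f Hf; rewrite /linear /= comp_idr in Hf.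
  exists ({| und := f; und_action := Hf |} : Hom A W); split; first exact: comp_idr.
  by move=> h Hh; apply: AlgHom_eq; rewrite /= -Hh /= comp_idr.
Qed.

(* Every map out of [X] is linear, so the universal map is X → T X. *)
Definition free_lin (X : C) : LinData X.
Proof.
  refine {| lin_act := idm X; lin_lax := eta T X; lin_sec := idm X |}.
  - exact: comp_idl.
  - exact: comp_idr.
Defined.

Lemma free_lin_linear (X : C) (W : EM T) (f : Hom X (carrier W)) : linear (free_lin X) f.
Proof. by rewrite /linear /= comp_idr -/(sharp f) sharp_eta. Qed.

Lemma free_lin_universal (X : C) : universal (free_lin X) (free_gen X).
Proof.
  split=> [|W f _]; first exact: free_lin_linear.
  exists (sharp_hom f); split; first exact: sharp_eta.
  move=> h <-; apply: AlgHom_eq.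
  apply: (eq_trans (eq_sym (und_sharp h (free_gen X)))); by rewrite /sharp /= mu_eta_r comp_idr.
Qed.

Lemma dense_id (A : EM T) : dense (idm (carrier A)).
Proof. exact: universal_dense (alg_lin_universal A). Qed.

Lemma dense_eta (X : C) : dense (free_gen X).
Proof. exact: universal_dense (free_lin_universal X). Qed.

(** * Universal linear maps as reflexive coequalizers *)

Context (HC : has_reflexive_coequalizers C) (HT : functor_preserves_rcoeq T).

(** The coequalizer [q] is taken in [C]. Since [T] preserves it, the free action on [T Y] descends
    to [Q], and the algebra laws hold because they hold after epimorphisms. *)
Lemma universal_exists (Y : C) (E : LinData Y) :
  exists (Q : EM T) (u : Hom Y (carrier Q)), universal E u /\
    is_coequalizer (fmap T (lin_act E)) (mu T Y ∘ fmap T (lin_lax E)) (sharp u).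
Proof.
  have Hr := lin_reflexive E.
  have [Q [q Hq]] := HC Hr.
  have HTq := HT Hr Hq.
  have HTTq : is_coequalizer (fmap T (fmap T (fmap T (lin_act E))))
     (fmap T (fmap T (mu T Y ∘ fmap T (lin_lax E)))) (fmap T (fmap T q)).
    exact: HT (fmap_reflexive T Hr) HTq.
  have [w [Hw _]] : exists! w, w ∘ fmap T q = q ∘ mu T Y.
    apply: (proj2 HTq); rewrite -!comp_assoc -mu_nat.
    rewrite (comp_assoc q) (proj1 Hq) -!comp_assoc mu_nat.
    by rewrite (comp_assoc (mu T Y)) mu_assoc -comp_assoc -fmap_comp.
  have Hwe : w ∘ eta T Q = idm Q.
    apply: (coequalizer_epi Hq); rewrite -comp_assoc -eta_nat comp_assoc Hw.
    by rewrite -comp_assoc mu_eta_l comp_idl comp_idr.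
  (* Associativity is an equation on [T (T Q)], so the coequalizer must be preserved by [T]
     twice. *)
  have Hwm : w ∘ mu T Q = w ∘ fmap T w.
    apply: (coequalizer_epi HTTq); rewrite -!comp_assoc -mu_nat -fmap_comp Hw.
    by rewrite fmap_comp !comp_assoc Hw -!comp_assoc mu_assoc.
  pose QA : EM T := {| carrier := Q; action := w; action_eta := Hwe; action_mu := Hwm |}.
  (* Restricting [q] to generators gives a map whose transpose is [q] again. *)
  pose u : Hom Y (carrier QA) := q ∘ eta T Y.
  have Eq : sharp u = q.
    by rewrite /sharp /u /= fmap_comp comp_assoc Hw -comp_assoc mu_eta_r comp_idr.
  exists QA, u; rewrite Eq; split=> //; split.
    by apply/linearE; rewrite Eq; exact: (proj1 Hq).
  move=> W f /linearE Hf.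
  have [k [Hk _]] := (proj2 Hq) _ _ Hf.
  have Ha : action W ∘ fmap T k = k ∘ action QA.
    apply: (coequalizer_epi HTq); rewrite -!comp_assoc -fmap_comp Hk /= Hw.
    by rewrite comp_assoc Hk sharp_mu.
  exists (@Build_AlgHom C T QA W k Ha); split.
    by rewrite /= /u comp_assoc Hk sharp_eta.
  move=> h Hh; apply: AlgHom_eq => /=; apply: (coequalizer_epi Hq).
  by rewrite Hk -Hh -und_sharp Eq.
Qed.

(** Universal maps for the same [E] differ by an isomorphism of algebras, so the coequalizer
    property transfers from the constructed one to any other. *)
Lemma universal_coequalizer (Y : C) (E : LinData Y) (Q : EM T) (u : Hom Y (carrier Q)) :
  universal E u ->
  is_coequalizer (fmap T (lin_act E)) (mu T Y ∘ fmap T (lin_lax E)) (sharp u).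
Proof.
  move=> Hu; have [Q' [u' [Hu' Hq]]] := universal_exists E.
  have Hid : lin_mor (E := E) (E' := E) (idm Y) (idm _).
    by split; rewrite ?fmap_id comp_idl comp_idr.
  have Hi (X : C) : is_iso (idm X) by exists (idm X); rewrite comp_idl.
  have [h [Hh _]] := over_ext Hid Hu' (proj1 Hu).
  have [k [Hk1 Hk2]] := over_iso Hid (Hi _) (Hi _) Hu' Hu Hh.
  rewrite -(comp_idr u) -Hh -und_sharp; apply: coequalizer_iso => //.
  by exists (und k); split; [move: (f_equal (@und _ _ _ _) Hk1) | move: (f_equal (@und _ _ _ _) Hk2)].
Qed.

End LinearMaps.

(** * Tensor products of linearity data and universality of composites *)

Section MonoidalAlgebras.
Context {C : Category} {ten : C -> C -> C} {I : C} {M : Monoidal ten I}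
        {T : Monad C} (phi : MonoidalMonad M T).

(** Joint linearity in two variables; with [alg_lin] in both slots it is, by computation,
    [multilinear] on a two-element list. *)
Definition ten_lin (Y1 Y2 : C) (E1 : LinData T Y1) (E2 : LinData T Y2) :
  LinData T (ten Y1 Y2).
Proof.
  refine {| lin_act := lin_act E1 ⊗[M] lin_act E2;
            lin_lax := lax2 phi Y1 Y2 ∘ (lin_lax E1 ⊗[M] lin_lax E2);
            lin_sec := lin_sec E1 ⊗[M] lin_sec E2 |}.
  - by rewrite -tenm_comp !lin_act_sec tenm_id.
  - by rewrite -comp_assoc -tenm_comp !lin_lax_sec eta_lax2.
Defined.

Fixpoint eta_list (l : list C) : Hom (ten_list (I := I) l) (ten_list (I := I) (map T l)) :=
  match l with
  | [] => idm I
  | A :: l' =>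
      match l' return Hom (ten_list (I := I) l') (ten_list (I := I) (map T l')) ->
                      Hom (ten_list (I := I) (A :: l')) (ten_list (I := I) (map T (A :: l')))
      with
      | [] => fun _ => eta T A
      | _ :: _ => fun r => eta T A ⊗[M] r
      end (eta_list l')
  end.

Lemma lax_eta_list (l : list C) : lax_list phi l ∘ eta_list l = eta T (ten_list (I := I) l).
Proof.
  elim: l => [|A [|B l] IH] /=; first by rewrite comp_idr eta_lax0.
    by rewrite comp_idl.
  rewrite /= in IH.
  by rewrite -comp_assoc -tenm_comp comp_idl IH eta_lax2.
Qed.

Lemma act_eta_list (l : list (Algebra T)) :
  act_list (M := M) l ∘ eta_list (map (@carrier C T) l) = idm (ten_alg l).
Proof.
  elim: l => [|A [|B l] IH] /=; first by rewrite comp_idl.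
    exact: action_eta.
  rewrite /= in IH.
  by rewrite -tenm_comp action_eta IH tenm_id.
Qed.

(** Casts [multilinear] as an instance of [linear], with the list of units as section, so that
    [universal_exists] yields universal maps of every arity. *)
Definition list_lin (l : list (Algebra T)) : LinData T (ten_alg (I := I) l) :=
  {| lin_act := act_list (M := M) l; lin_lax := lax_list phi (map (@carrier C T) l);
     lin_sec := eta_list (map (@carrier C T) l);
     lin_act_sec := act_eta_list l; lin_lax_sec := lax_eta_list _ |}.

Context (HC : has_reflexive_coequalizers C) (HT : functor_preserves_rcoeq T)
        (HM : tensor_preserves_rcoeq M).

Lemma multilinear_universal (l : list (Algebra T)) : inhabited (UniversalMultilinear phi l).
Proof.
  have [Q [u [[Hl Hu] _]]] := universal_exists HC HT (list_lin l).
  by split; exists Q u.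
Qed.

Context (v : UniversalBilinear phi).

Definition ten_gen (Y1 Y2 : C) (Q1 Q2 : EM T) (u1 : Hom Y1 (carrier Q1))
    (u2 : Hom Y2 (carrier Q2)) : Hom (ten Y1 Y2) (carrier (tenT v Q1 Q2)) :=
  univ v Q1 Q2 ∘ (u1 ⊗[M] u2).

Lemma univ_universal (A B : EM T) : universal (ten_lin (alg_lin A) (alg_lin B)) (univ v A B).
Proof. split; [exact: (um_multilinear (v A B)) | exact: (@um_universal _ _ _ _ _ _ _ (v A B))]. Qed.

Lemma ten_gen_linear (Y1 Y2 : C) (E1 : LinData T Y1) (E2 : LinData T Y2) (Q1 Q2 : EM T)
    (u1 : Hom Y1 (carrier Q1)) (u2 : Hom Y2 (carrier Q2)) :
  linear E1 u1 -> linear E2 u2 -> linear (ten_lin E1 E2) (ten_gen u1 u2).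
Proof.
  move=> H1 H2; rewrite /linear /ten_gen fmap_comp /=.
  have := proj1 (univ_universal Q1 Q2); rewrite /linear /= tenm_id comp_idr => Hv.
  rewrite -!comp_assoc (comp_assoc _ (lax2 phi _ _)) -lax2_nat -!comp_assoc -!tenm_comp.
  rewrite (comp_assoc _ (lax2 phi _ _)) (comp_assoc (action _)) (comp_assoc (action _)) Hv.
  by rewrite -!comp_assoc -tenm_comp !comp_assoc H1 H2.
Qed.

(** Bilinearity of [g] moves both actions outside. Hence [g] on the transposes depends only on
    [g ∘ (u1 ⊗ u2)], which gives uniqueness in [ten_gen_universal]. *)
Lemma sharp_ten (Y1 Y2 : C) (Q1 Q2 W : EM T) (u1 : Hom Y1 (carrier Q1))
    (u2 : Hom Y2 (carrier Q2)) (g : Hom (ten (carrier Q1) (carrier Q2)) (carrier W)) :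
  linear (ten_lin (alg_lin Q1) (alg_lin Q2)) g ->
  g ∘ (sharp u1 ⊗[M] sharp u2) = sharp (g ∘ (u1 ⊗[M] u2)) ∘ lax2 phi Y1 Y2.
Proof.
  rewrite /linear /= tenm_id comp_idr => Hg.
  rewrite /sharp tenm_comp comp_assoc -Hg -!comp_assoc lax2_nat.
  by rewrite (comp_assoc (fmap T g)) -fmap_comp.
Qed.

(** The map [sharp u1 ⊗ sharp u2] is a coequalizer of the tensored pairs. Linearity of [f] makes
    [sharp f ∘ lax2] descend along it to a map [g], which is bilinear and therefore factors through
    [univ]. *)
Lemma ten_gen_universal (Y1 Y2 : C) (E1 : LinData T Y1) (E2 : LinData T Y2) (Q1 Q2 : EM T)
    (u1 : Hom Y1 (carrier Q1)) (u2 : Hom Y2 (carrier Q2)) :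
  universal E1 u1 -> universal E2 u2 -> universal (ten_lin E1 E2) (ten_gen u1 u2).
Proof.
  move=> H1 H2.
  have Hr1 := lin_reflexive E1; have Hr2 := lin_reflexive E2.
  have Hq1 := universal_coequalizer HC HT H1.
  have Hq2 := universal_coequalizer HC HT H2.
  have Hq := tenm_coequalizer HM Hr1 Hq1 Hr2 Hq2.
  have HTq := tenm_coequalizer HM (fmap_reflexive T Hr1) (HT Hr1 Hq1)
                (fmap_reflexive T Hr2) (HT Hr2 Hq2).
  split; first exact: ten_gen_linear (proj1 H1) (proj1 H2).
  move=> W f Hf.
  have [g [Hg _]] : exists! g, g ∘ (sharp u1 ⊗[M] sharp u2) = sharp f ∘ lax2 phi Y1 Y2.
    apply: (proj2 Hq).
    rewrite -!comp_assoc lax2_nat tenm_comp (comp_assoc (lax2 phi _ _)) -mu_lax2.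
    rewrite -!comp_assoc lax2_nat !comp_assoc; congr (_ ∘ _).
    have := proj1 (linearE (ten_lin E1 E2) f) Hf.
    by rewrite /sharp -!comp_assoc -!fmap_comp.
  (* Bilinearity of [g] is tested after [T (sharp u1) ⊗ T (sharp u2)], which is epi because [T] and
     the tensor preserve the coequalizers. *)
  have Hgl : linear (ten_lin (alg_lin Q1) (alg_lin Q2)) g.
    rewrite /linear /= tenm_id comp_idr; apply: (coequalizer_epi HTq).
    rewrite -!comp_assoc lax2_nat (comp_assoc (fmap T g)) -fmap_comp Hg.
    rewrite -tenm_comp fmap_comp.
    rewrite !sharp_hom_action tenm_comp (comp_assoc g) Hg -!comp_assoc -mu_lax2.
    by rewrite !comp_assoc sharp_hom_action.
  have [h [Hh _]] := proj2 (univ_universal Q1 Q2) _ _ Hgl.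
  exists h; split.
    rewrite /ten_gen comp_assoc Hh -(sharp_eta u1) -(sharp_eta u2) tenm_comp comp_assoc Hg.
    by rewrite -comp_assoc eta_lax2 sharp_eta.
  move=> k Hk; apply: (dense_inj (universal_dense (univ_universal Q1 Q2))).
  rewrite [LHS]Hh; apply: (coequalizer_epi Hq); rewrite Hg.
  rewrite sharp_ten; first exact: (linear_postcomp k (proj1 (univ_universal Q1 Q2))).
  by rewrite -comp_assoc Hk.
Qed.

(** * Associator and unitors as morphisms of linearity data *)

Lemma lin_mor_assoc (Y1 Y2 Y3 : C) (E1 : LinData T Y1) (E2 : LinData T Y2)
    (E3 : LinData T Y3) :
  lin_mor (E := ten_lin (ten_lin E1 E2) E3) (E' := ten_lin E1 (ten_lin E2 E3))
    (assoc M Y1 Y2 Y3) (assoc M (lin_dom E1) (lin_dom E2) (lin_dom E3)).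
Proof.
  split; rewrite /=; first exact: assoc_nat.
  have E (A A' A'' B B' : C) (f : Hom A' A'') (g : Hom A A') (h : Hom B B') :
      (f ∘ g) ⊗[M] h = (f ⊗[M] idm B') ∘ (g ⊗[M] h).
    by rewrite -tenm_comp comp_idl.
  have E' (A A' A'' B B' : C) (f : Hom A' A'') (g : Hom A A') (h : Hom B B') :
      h ⊗[M] (f ∘ g) = (idm B' ⊗[M] f) ∘ (h ⊗[M] g).
    by rewrite -tenm_comp comp_idl.
  by rewrite E E' !comp_assoc lax_assoc -!comp_assoc assoc_nat.
Qed.

(** The unit slot carries [free_lin T I], whose universal map is I → T I; this lets the unitor of
    [C], which starts from I and not from T I, induce the one for algebras. *)
Lemma lin_mor_lunit (Y : C) (E : LinData T Y) :
  lin_mor (E := ten_lin (free_lin T I) E) (E' := E) (lunit M Y) (lunit M (lin_dom E)).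
Proof.
  split; rewrite /=; first exact: lunit_nat.
  rewrite -(eta_lax0 phi) -(comp_idr (lax0 phi)) -{1}(comp_idl (lin_lax E)) tenm_comp.
  by rewrite !comp_assoc lax_lunit lunit_nat.
Qed.

Lemma lin_mor_runit (Y : C) (E : LinData T Y) :
  lin_mor (E := ten_lin E (free_lin T I)) (E' := E) (runit M Y) (runit M (lin_dom E)).
Proof.
  split; rewrite /=; first exact: runit_nat.
  rewrite -(eta_lax0 phi) -(comp_idr (lax0 phi)) -{1}(comp_idl (lin_lax E)) tenm_comp.
  by rewrite !comp_assoc lax_runit runit_nat.
Qed.

Lemma dense_ten_gen (Y1 Y2 : C) (Q1 Q2 : EM T) (u1 : Hom Y1 (carrier Q1))
    (u2 : Hom Y2 (carrier Q2)) :
  dense u1 -> dense u2 -> dense (ten_gen u1 u2).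
Proof. by move=> [E1 H1] [E2 H2]; exact: universal_dense (ten_gen_universal H1 H2). Qed.

Lemma ten_gen_comp (X1 X2 Y1 Y2 : C) (Q1 Q2 : EM T) (u1 : Hom Y1 (carrier Q1))
    (u2 : Hom Y2 (carrier Q2)) (f1 : Hom X1 Y1) (f2 : Hom X2 Y2) :
  ten_gen (u1 ∘ f1) (u2 ∘ f2) = ten_gen u1 u2 ∘ (f1 ⊗[M] f2).
Proof. by rewrite /ten_gen tenm_comp comp_assoc. Qed.

(** * The monoidal category of algebras *)

Lemma tenT_map_ex (A A' B B' : EM T) (f : Hom A A') (g : Hom B B') :
  exists! h : Hom (tenT v A B) (tenT v A' B'),
    und h ∘ univ v A B = univ v A' B' ∘ (und f ⊗[M] und g).
Proof.
  apply: (proj2 (univ_universal A B)); apply: ten_gen_linear.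
    by move: (linear_postcomp f (proj1 (alg_lin_universal A))); rewrite comp_idr.
  by move: (linear_postcomp g (proj1 (alg_lin_universal B))); rewrite comp_idr.
Qed.

Lemma tenT_assoc_ex (A B D : EM T) :
  exists! h : Hom (tenT v (tenT v A B) D) (tenT v A (tenT v B D)),
    und h ∘ univ v (tenT v A B) D ∘ (univ v A B ⊗[M] idm (carrier D))
    = univ v A (tenT v B D) ∘ (idm (carrier A) ⊗[M] univ v B D)
      ∘ assoc M (carrier A) (carrier B) (carrier D).
Proof.
  apply: (@unique_exists_iff _ (over (ten_gen (univ v A B) (idm (carrier D)))
    (ten_gen (idm (carrier A)) (univ v B D)) (assoc M _ _ _))).
    by move=> h; rewrite /over /ten_gen !comp_assoc.
  apply: (over_ext (lin_mor_assoc (alg_lin A) (alg_lin B) (alg_lin D))).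
    exact: ten_gen_universal (univ_universal A B) (alg_lin_universal D).
  exact: (proj1 (ten_gen_universal (alg_lin_universal A) (univ_universal B D))).
Qed.

Lemma tenT_lunit_ex (A : EM T) :
  exists! h : Hom (tenT v (Free T I) A) A,
    und h ∘ univ v (Free T I) A ∘ (lax0 phi ⊗[M] idm (carrier A)) = lunit M (carrier A).
Proof.
  apply: (@unique_exists_iff _ (over (ten_gen (free_gen T I) (idm (carrier A)))
    (idm (carrier A)) (lunit M _))).
    by move=> h; rewrite /over /ten_gen /free_gen eta_lax0 comp_assoc comp_idl.
  apply: (over_ext (lin_mor_lunit (alg_lin A))).
    exact: ten_gen_universal (free_lin_universal T I) (alg_lin_universal A).
  exact: (proj1 (alg_lin_universal A)).
Qed.

Lemma tenT_runit_ex (A : EM T) :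
  exists! h : Hom (tenT v A (Free T I)) A,
    und h ∘ univ v A (Free T I) ∘ (idm (carrier A) ⊗[M] lax0 phi) = runit M (carrier A).
Proof.
  apply: (@unique_exists_iff _ (over (ten_gen (idm (carrier A)) (free_gen T I))
    (idm (carrier A)) (runit M _))).
    by move=> h; rewrite /over /ten_gen /free_gen eta_lax0 comp_assoc comp_idl.
  apply: (over_ext (lin_mor_runit (alg_lin A))).
    exact: ten_gen_universal (alg_lin_universal A) (free_lin_universal T I).
  exact: (proj1 (alg_lin_universal A)).
Qed.

(** Turns unique existence into data; the retained uniqueness proofs become the clauses of
    [induced_monoidal]. *)
Definition tenT_map_sig (A A' B B' : EM T) (f : Hom A A') (g : Hom B B') :=
  constructive_indefinite_description _ (tenT_map_ex f g).
Definition tenT_assoc_sig (A B D : EM T) :=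
  constructive_indefinite_description _ (tenT_assoc_ex A B D).
Definition tenT_lunit_sig (A : EM T) :=
  constructive_indefinite_description _ (tenT_lunit_ex A).
Definition tenT_runit_sig (A : EM T) :=
  constructive_indefinite_description _ (tenT_runit_ex A).

Definition tenT_map (A A' B B' : EM T) (f : Hom A A') (g : Hom B B') :
  Hom (tenT v A B) (tenT v A' B') := proj1_sig (tenT_map_sig f g).
Definition tenT_assoc (A B D : EM T) :
  Hom (tenT v (tenT v A B) D) (tenT v A (tenT v B D)) := proj1_sig (tenT_assoc_sig A B D).
Definition tenT_lunit (A : EM T) : Hom (tenT v (Free T I) A) A :=
  proj1_sig (tenT_lunit_sig A).
Definition tenT_runit (A : EM T) : Hom (tenT v A (Free T I)) A :=
  proj1_sig (tenT_runit_sig A).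

Lemma over_tenT_map (Y1 Y2 Y1' Y2' : C) (Q1 Q2 Q1' Q2' : EM T)
    (u1 : Hom Y1 (carrier Q1)) (u2 : Hom Y2 (carrier Q2))
    (u1' : Hom Y1' (carrier Q1')) (u2' : Hom Y2' (carrier Q2'))
    (m1 : Hom Y1 Y1') (m2 : Hom Y2 Y2') (h1 : Hom Q1 Q1') (h2 : Hom Q2 Q2') :
  over u1 u1' m1 h1 -> over u2 u2' m2 h2 ->
  over (ten_gen u1 u2) (ten_gen u1' u2') (m1 ⊗[M] m2) (tenT_map h1 h2).
Proof.
  rewrite /over => H1 H2; rewrite -ten_gen_comp -H1 -H2 /ten_gen comp_assoc.
  by rewrite (proj1 (proj2_sig (tenT_map_sig h1 h2))) -comp_assoc -tenm_comp.
Qed.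

(** The defining equation is the case of identity generators; naturality of the associator of [C]
    extends it to arbitrary ones. *)
Lemma over_tenT_assoc (Y1 Y2 Y3 : C) (Q1 Q2 Q3 : EM T) (u1 : Hom Y1 (carrier Q1))
    (u2 : Hom Y2 (carrier Q2)) (u3 : Hom Y3 (carrier Q3)) :
  over (ten_gen (ten_gen u1 u2) u3) (ten_gen u1 (ten_gen u2 u3)) (assoc M Y1 Y2 Y3)
    (tenT_assoc Q1 Q2 Q3).
Proof.
  have H := proj1 (proj2_sig (tenT_assoc_sig Q1 Q2 Q3)).
  rewrite /over /ten_gen -{1}(comp_idl u3) -{2}(comp_idl u1) !tenm_comp !comp_assoc H.
  by rewrite -!comp_assoc assoc_nat.
Qed.

Lemma over_tenT_lunit (Y : C) (Q : EM T) (u : Hom Y (carrier Q)) :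
  over (ten_gen (free_gen T I) u) u (lunit M Y) (tenT_lunit Q).
Proof.
  have := proj1 (proj2_sig (tenT_lunit_sig Q)); rewrite -/(tenT_lunit Q) eta_lax0 => H.
  rewrite /over /ten_gen /free_gen -lunit_nat -H -!comp_assoc -tenm_comp.
  by rewrite comp_idl comp_idr.
Qed.

Lemma over_tenT_runit (Y : C) (Q : EM T) (u : Hom Y (carrier Q)) :
  over (ten_gen u (free_gen T I)) u (runit M Y) (tenT_runit Q).
Proof.
  have := proj1 (proj2_sig (tenT_runit_sig Q)); rewrite -/(tenT_runit Q) eta_lax0 => H.
  rewrite /over /ten_gen /free_gen -runit_nat -H -!comp_assoc -tenm_comp.
  by rewrite comp_idl comp_idr.
Qed.

Lemma tenT_assoc_iso (A B D : EM T) : is_iso (tenT_assoc A B D).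
Proof.
  apply: (over_iso (lin_mor_assoc (alg_lin A) (alg_lin B) (alg_lin D))
           (assoc_iso _ _ _ _) (assoc_iso _ _ _ _) _ _ (over_tenT_assoc _ _ _)).
    by do !apply: ten_gen_universal; exact: alg_lin_universal.
  by do !apply: ten_gen_universal; exact: alg_lin_universal.
Qed.

Lemma tenT_lunit_iso (A : EM T) : is_iso (tenT_lunit A).
Proof.
  apply: (over_iso (lin_mor_lunit (alg_lin A))
           (lunit_iso _ _) (lunit_iso _ _) _ _ (over_tenT_lunit _)).
    exact: ten_gen_universal (free_lin_universal T I) (alg_lin_universal A).
  exact: alg_lin_universal.
Qed.

Lemma tenT_runit_iso (A : EM T) : is_iso (tenT_runit A).
Proof.
  apply: (over_iso (lin_mor_runit (alg_lin A))
           (runit_iso _ _) (runit_iso _ _) _ _ (over_tenT_runit _)).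
    exact: ten_gen_universal (alg_lin_universal A) (free_lin_universal T I).
  exact: alg_lin_universal.
Qed.

(** Each axiom lies over the same axiom of [C] along a dense map built from identities for algebra
    variables and [free_gen T I] for unit factors. *)
Definition EM_monoidal : Monoidal (tenT v) (Free T I).
Proof.
  refine {| tenm := tenT_map; assoc := tenT_assoc; assoc_iso := tenT_assoc_iso;
            lunit := tenT_lunit; lunit_iso := tenT_lunit_iso;
            runit := tenT_runit; runit_iso := tenT_runit_iso |}.
  - move=> A B; apply: (over_eq (dense_ten_gen (dense_id A) (dense_id B))
        (over_tenT_map (over_id _) (over_id _)) (over_id _)); exact: tenm_id.
  - move=> A A' A'' B B' B'' f' f g' g.
    apply: (over_eq (dense_ten_gen (dense_id A) (dense_id B))
      (over_tenT_map (over_und _) (over_und _))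
      (over_comp (over_tenT_map (over_und _) (over_und _))
                 (over_tenT_map (over_und _) (over_und _)))); exact: tenm_comp.
  - move=> A A' B B' D D' f g h.
    apply: (over_eq (dense_ten_gen (dense_ten_gen (dense_id A) (dense_id B)) (dense_id D))
      (over_comp (over_tenT_assoc _ _ _)
        (over_tenT_map (over_tenT_map (over_und _) (over_und _)) (over_und _)))
      (over_comp (over_tenT_map (over_und _) (over_tenT_map (over_und _) (over_und _)))
        (over_tenT_assoc _ _ _))); exact: assoc_nat.
  - move=> A A' f.
    apply: (over_eq (dense_ten_gen (dense_eta T I) (dense_id A))
      (over_comp (over_tenT_lunit _) (over_tenT_map (over_id _) (over_und _)))
      (over_comp (over_und _) (over_tenT_lunit _))); exact: lunit_nat.
  - move=> A A' f.
    apply: (over_eq (dense_ten_gen (dense_id A) (dense_eta T I))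
      (over_comp (over_tenT_runit _) (over_tenT_map (over_und _) (over_id _)))
      (over_comp (over_und _) (over_tenT_runit _))); exact: runit_nat.
  - move=> A B.
    apply: (over_eq
      (dense_ten_gen (dense_ten_gen (dense_id A) (dense_eta T I)) (dense_id B))
      (over_comp (over_tenT_map (over_id _) (over_tenT_lunit _)) (over_tenT_assoc _ _ _))
      (over_tenT_map (over_tenT_runit _) (over_id _))); exact: triangle.
  - move=> A B D E.
    apply: (over_eq
      (dense_ten_gen (dense_ten_gen (dense_ten_gen (dense_id A) (dense_id B)) (dense_id D))
        (dense_id E))
      (over_comp (over_tenT_assoc _ _ _) (over_tenT_assoc _ _ _))
      (over_comp (over_comp (over_tenT_map (over_id _) (over_tenT_assoc _ _ _))
        (over_tenT_assoc _ _ _)) (over_tenT_map (over_tenT_assoc _ _ _) (over_id _))));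
      exact: pentagon.
Defined.

Lemma EM_monoidal_induced : induced_monoidal EM_monoidal.
Proof.
  split=> [A A' B B' f g|A B D|A|A].
  - exact: (proj2_sig (tenT_map_sig f g)).
  - exact: (proj2_sig (tenT_assoc_sig A B D)).
  - exact: (proj2_sig (tenT_lunit_sig A)).
  - exact: (proj2_sig (tenT_runit_sig A)).
Qed.

(** * Strong monoidality of the free algebra functor *)

Lemma free_ten_ex (X Y : C) :
  exists! h : Hom (tenT v (Free T X) (Free T Y)) (Free T (ten X Y)),
    und h ∘ univ v (Free T X) (Free T Y) = lax2 phi X Y.
Proof.
  apply: (proj2 (univ_universal _ _) (Free T (ten X Y))).
  by rewrite /linear /= tenm_id comp_idr -comp_assoc mu_lax2.
Qed.

Definition free_ten_sig (X Y : C) := constructive_indefinite_description _ (free_ten_ex X Y).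
Definition free_ten (X Y : C) : Hom (tenT v (Free T X) (Free T Y)) (Free T (ten X Y)) :=
  proj1_sig (free_ten_sig X Y).

(** Both algebras are generated by X ⊗ Y, so the comparison lies over an identity; invertibility and
    the coherence laws then become nearly trivial equations in [C]. *)
Lemma over_free_ten (X Y : C) :
  over (ten_gen (free_gen T X) (free_gen T Y)) (free_gen T (ten X Y)) (idm (ten X Y))
    (free_ten X Y).
Proof.
  have H := proj1 (proj2_sig (free_ten_sig X Y)).
  by rewrite /over /ten_gen comp_assoc H comp_idr; exact: eta_lax2.
Qed.

Lemma free_ten_iso (X Y : C) : is_iso (free_ten X Y).
Proof.
  have Hi : is_iso (idm (ten X Y)) by exists (idm _); rewrite comp_idl.
  have Hm : lin_mor (E := ten_lin (free_lin T X) (free_lin T Y))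
                    (E' := free_lin T (ten X Y)) (idm (ten X Y)) (idm (ten X Y)).
    split; rewrite /=; first by rewrite tenm_id.
    by rewrite fmap_id comp_idl eta_lax2 comp_idr.
  apply: (over_iso Hm Hi Hi _ _ (over_free_ten X Y)).
    by apply: ten_gen_universal; exact: free_lin_universal.
  exact: free_lin_universal.
Qed.

Definition Free_lax : LaxMonoidal M EM_monoidal (Free T).
Proof.
  refine {| lax2 := free_ten : forall X Y, Hom (tenT v (Free T X) (Free T Y)) _;
            lax0 := idm (Free T I) |}.
  - move=> A A' B B' f g.
    apply: (over_eq (dense_ten_gen (dense_eta T A) (dense_eta T B))
      (over_comp (over_free_ten _ _) (over_tenT_map (over_eta _ _) (over_eta _ _)))
      (over_comp (over_eta _ _) (over_free_ten _ _))).
    by rewrite comp_idl comp_idr.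
  - move=> A B E.
    apply: (over_eq
      (dense_ten_gen (dense_ten_gen (dense_eta T A) (dense_eta T B)) (dense_eta T E))
      (over_comp (over_comp (over_eta _ _) (over_free_ten _ _))
        (over_tenT_map (over_free_ten _ _) (over_id _)))
      (over_comp (over_comp (over_free_ten _ _)
        (over_tenT_map (over_id _) (over_free_ten _ _))) (over_tenT_assoc _ _ _))).
    by rewrite !tenm_id !comp_idl !comp_idr.
  - move=> A.
    apply: (over_eq (dense_ten_gen (dense_eta T I) (dense_eta T A))
      (over_comp (over_comp (over_eta _ _) (over_free_ten _ _))
        (over_tenT_map (over_id _) (over_id _)))
      (over_tenT_lunit _)).
    by rewrite tenm_id !comp_idr.
  - move=> A.
    apply: (over_eq (dense_ten_gen (dense_eta T A) (dense_eta T I))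
      (over_comp (over_comp (over_eta _ _) (over_free_ten _ _))
        (over_tenT_map (over_id _) (over_id _)))
      (over_tenT_runit _)).
    by rewrite tenm_id !comp_idr.
Defined.

Lemma Free_lax_strong : is_strong Free_lax.
Proof. by split; [exact: free_ten_iso | exists (idm _); rewrite comp_idl]. Qed.

End MonoidalAlgebras.

(** * The duoidal structure on algebras *)

Section DuoidalAlgebras.
Context {C : Category} {dia : C -> C -> C} {I : C} {star : C -> C -> C} {J : C}
        {D : Duoidal dia I star J} (T : DoubleMonoidalMonad D)
        (HC : has_reflexive_coequalizers C) (HT : functor_preserves_rcoeq T)
        (Hdia : tensor_preserves_rcoeq (diam D)) (Hstar : tensor_preserves_rcoeq (starm D))
        (v : UniversalBilinear (dphi T)) (u : UniversalBilinear (dgamma T)).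

(** Compatibility with the actions is naturality of [zeta]; compatibility with the lax maps is the
    equation [double_zeta] of the monad combined with naturality. *)
Lemma lin_mor_zeta (Y1 Y2 Y3 Y4 : C) (E1 : LinData T Y1) (E2 : LinData T Y2)
    (E3 : LinData T Y3) (E4 : LinData T Y4) :
  lin_mor (E := ten_lin (dphi T) (ten_lin (dgamma T) E1 E2) (ten_lin (dgamma T) E3 E4))
    (E' := ten_lin (dgamma T) (ten_lin (dphi T) E1 E3) (ten_lin (dphi T) E2 E4))
    (zeta D Y1 Y2 Y3 Y4) (zeta D _ _ _ _).
Proof.
  split; rewrite /=; first exact: zeta_nat.
  rewrite !tenm_comp !comp_assoc (double_zeta (ddouble T)) -!comp_assoc.
  by rewrite zeta_nat.
Qed.

Lemma zetaT_ex (A B X Y : EM T) :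
  exists! h : Hom (tenT v (tenT u A B) (tenT u X Y)) (tenT u (tenT v A X) (tenT v B Y)),
    und h ∘ univ v (tenT u A B) (tenT u X Y) ∘ (univ u A B ⊗[diam D] univ u X Y)
    = univ u (tenT v A X) (tenT v B Y) ∘ (univ v A X ⊗[starm D] univ v B Y)
      ∘ zeta D (carrier A) (carrier B) (carrier X) (carrier Y).
Proof.
  apply: (@unique_exists_iff _ (over (ten_gen v (univ u A B) (univ u X Y))
    (ten_gen u (univ v A X) (univ v B Y)) (zeta D _ _ _ _))).
    by move=> h; rewrite /over /ten_gen !comp_assoc.
  apply: (over_ext (lin_mor_zeta (alg_lin A) (alg_lin B) (alg_lin X) (alg_lin Y))).
    by apply: ten_gen_universal => //; exact: univ_universal.
  by apply: ten_gen_linear; exact: (proj1 (univ_universal _ _ _)).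
Qed.

Definition zetaT_sig (A B X Y : EM T) :=
  constructive_indefinite_description _ (zetaT_ex A B X Y).
Definition zetaT (A B X Y : EM T) :
  Hom (tenT v (tenT u A B) (tenT u X Y)) (tenT u (tenT v A X) (tenT v B Y)) :=
  proj1_sig (zetaT_sig A B X Y).

Lemma over_zetaT (Y1 Y2 Y3 Y4 : C) (Q1 Q2 Q3 Q4 : EM T) (u1 : Hom Y1 (carrier Q1))
    (u2 : Hom Y2 (carrier Q2)) (u3 : Hom Y3 (carrier Q3)) (u4 : Hom Y4 (carrier Q4)) :
  over (ten_gen v (ten_gen u u1 u2) (ten_gen u u3 u4))
    (ten_gen u (ten_gen v u1 u3) (ten_gen v u2 u4))
    (zeta D Y1 Y2 Y3 Y4) (zetaT Q1 Q2 Q3 Q4).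
Proof.
  have H := proj1 (proj2_sig (zetaT_sig Q1 Q2 Q3 Q4)).
  rewrite /over /ten_gen !tenm_comp !comp_assoc H -!comp_assoc.
  by rewrite zeta_nat.
Qed.

Notation vM := (EM_monoidal HC HT Hdia v).
Notation uM := (EM_monoidal HC HT Hstar u).
Notation phib := (Free_lax HC HT Hdia v).
Notation gammab := (Free_lax HC HT Hstar u).

(** This is gammab⁻¹ ∘ T delta, given by its value on generators so that no inverse has to be
    chosen. *)
Definition deltaT : Hom (Free T I) (tenT u (Free T I) (Free T I)) :=
  sharp_hom (ten_gen u (free_gen T I) (free_gen T I) ∘ delta D).
Definition thetaT : Hom (tenT v (Free T J) (Free T J)) (Free T J) :=
  fmap (Free T) (theta D) ∘ lax2 phib J J.
Definition zeta0T : Hom (Free T I) (Free T J) := fmap (Free T) (zeta0 D).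

Lemma over_deltaT :
  over (free_gen T I) (ten_gen u (free_gen T I) (free_gen T I)) (delta D) deltaT.
Proof. exact: sharp_eta. Qed.

Lemma over_thetaT :
  over (ten_gen v (free_gen T J) (free_gen T J)) (free_gen T J) (theta D) thetaT.
Proof.
  rewrite -(comp_idr (theta D)).
  exact: over_comp (over_eta T (theta D)) (over_free_ten v J J).
Qed.

(** Follows the syntax of the morphism. In a composite the inner factor is treated first, since its
    known source generator fixes the intermediate generator needed by the outer one. *)
Ltac over_tac :=
  lazymatch goal with
  | |- over _ _ _ (_ ∘ _) => eapply over_comp; cycle 1; [over_tac | over_tac]
  | |- over _ _ _ (idm _) => exact: over_id
  | |- over _ _ _ (tenm vM _ _) => apply: (over_tenT_map v); over_tac
  | |- over _ _ _ (tenm uM _ _) => apply: (over_tenT_map u); over_tac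
  | |- over _ _ _ (assoc vM _ _ _) => exact: (over_tenT_assoc HC HT Hdia v)
  | |- over _ _ _ (assoc uM _ _ _) => exact: (over_tenT_assoc HC HT Hstar u)
  | |- over _ _ _ (lunit vM _) => exact: (over_tenT_lunit HC HT Hdia v)
  | |- over _ _ _ (lunit uM _) => exact: (over_tenT_lunit HC HT Hstar u)
  | |- over _ _ _ (runit vM _) => exact: (over_tenT_runit HC HT Hdia v)
  | |- over _ _ _ (runit uM _) => exact: (over_tenT_runit HC HT Hstar u)
  | |- over _ _ _ (lax2 phib _ _) => exact: (over_free_ten v)
  | |- over _ _ _ (lax2 gammab _ _) => exact: (over_free_ten u)
  | |- over _ _ _ (lax0 _) => exact: over_id
  | |- over _ _ _ (fmap (Free _) _) => exact: over_eta
  | |- over _ _ _ (zetaT _ _ _ _) => exact: over_zetaT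
  | |- over _ _ _ deltaT => exact: over_deltaT
  | |- over _ _ _ thetaT => exact: over_thetaT
  | |- over _ _ _ zeta0T => exact: over_eta
  | |- over _ _ _ _ => exact: over_und
  end.

Ltac dense_tac :=
  repeat first [exact: dense_id | exact: dense_eta
    | apply: (dense_ten_gen HC HT Hdia) | apply: (dense_ten_gen HC HT Hstar)].

(* Reduces an equation in [EM T] to the equation in [C] that it lies over along the
   dense map [gen]. *)
Tactic Notation "lift" uconstr(gen) :=
  eapply (over_eq (u := gen)); [dense_tac | over_tac | over_tac | ].

Notation "a ⋄ b" := (ten_gen v a b) (at level 37, left associativity).
Notation "a ⋆ b" := (ten_gen u a b) (at level 37, left associativity).
Notation "'ι' A" := (idm (carrier A)) (at level 9, A at level 9).
Notation "'η' X" := (free_gen T X) (at level 9, X at level 9).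

Definition EM_duoidal : Duoidal (tenT v) (Free T I) (tenT u) (Free T J).
Proof.
  refine {| diam := vM; starm := uM; zeta := zetaT; delta := deltaT; theta := thetaT;
            zeta0 := zeta0T |}.
  - move=> A A' B B' X X' Y Y' a b x y.
    lift ((ι A ⋆ ι B) ⋄ (ι X ⋆ ι Y)); exact: zeta_nat.
  - move=> A X B Y E Z.
    lift ((ι A ⋆ ι X) ⋄ (ι B ⋆ ι Y) ⋄ (ι E ⋆ ι Z)); exact: zeta_dia_assoc.
  - move=> A B E X Y Z.
    lift ((ι A ⋆ ι B ⋆ ι E) ⋄ (ι X ⋆ ι Y ⋆ ι Z)); exact: zeta_star_assoc.
  - move=> A B; lift (η I ⋄ (ι A ⋆ ι B)); exact: zeta_delta_l.
  - move=> A B; lift ((ι A ⋆ ι B) ⋄ η I); exact: zeta_delta_r.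
  - move=> A B; lift ((η J ⋆ ι A) ⋄ (η J ⋆ ι B)); exact: zeta_theta_l.
  - move=> A B; lift ((ι A ⋆ η J) ⋄ (ι B ⋆ η J)); exact: zeta_theta_r.
  - lift (η J ⋄ η J ⋄ η J); exact: theta_assoc.
  - lift (η I ⋄ η J); exact: theta_unit_l.
  - lift (η J ⋄ η I); exact: theta_unit_r.
  - lift (η I); exact: delta_coassoc.
  - lift (η I); exact: delta_counit_l.
  - lift (η I); exact: delta_counit_r.
Defined.

(** Since [phib] and [gammab] lie over identities, each equation reduces in [C] to a structure map
    being equal to itself. *)
Lemma Free_double_monoidal :
  double_monoidal (dC := D) (dD := EM_duoidal) phib gammab.
Proof.
  split; cbn [diam starm zeta delta theta zeta0 EM_duoidal].
  - move=> A B X Y.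
    lift ((η A ⋆ η B) ⋄ (η X ⋆ η Y)).
    by rewrite !tenm_id !comp_idl !comp_idr.
  - lift (η I); by rewrite tenm_id !comp_idl comp_idr.
  - lift (η J ⋄ η J); by rewrite tenm_id !comp_idl !comp_idr.
  - lift (η I); by rewrite comp_idl comp_idr.
Qed.

Lemma EM_duoidal_induced :
  @induced_duoidal _ _ _ _ _ _ T v u EM_duoidal phib gammab.
Proof.
  split=> //.
  - exact: EM_monoidal_induced.
  - exact: EM_monoidal_induced.
  - move=> X Y; exact: (proj2_sig (free_ten_sig v X Y)).
  - move=> X Y; exact: (proj2_sig (free_ten_sig u X Y)).
  - move=> A B X Y; exact: (proj2_sig (zetaT_sig A B X Y)).
  (* As [gammab] lies over an identity, both sides lie over [delta D]. *)
  - change (lax2 gammab I I ∘ deltaT = fmap (Free T) (delta D)).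
    lift (η I); exact: comp_idl.
Qed.

End DuoidalAlgebras.

Theorem theorem6p1 :
  forall (C : Category) (dia : C -> C -> C) (I : C) (star : C -> C -> C) (J : C)
    (D : Duoidal dia I star J) (T : DoubleMonoidalMonad D),
  has_reflexive_coequalizers C ->
  functor_preserves_rcoeq T ->
  tensor_preserves_rcoeq (diam D) ->
  tensor_preserves_rcoeq (starm D) ->
  (forall l : list (EM T),
     inhabited (UniversalMultilinear (dphi T) l) /\
     inhabited (UniversalMultilinear (dgamma T) l)) /\
  forall (v : UniversalBilinear (dphi T)) (u : UniversalBilinear (dgamma T)),
  exists (DT : Duoidal (tenT v) (Free T I) (tenT u) (Free T J))
    (phib : LaxMonoidal (diam D) (diam DT) (Free T))
    (gammab : LaxMonoidal (starm D) (starm DT) (Free T)),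
  induced_duoidal phib gammab /\
  is_strong phib /\ is_strong gammab /\ double_monoidal phib gammab.
Proof.
  move=> C dia I star J D T HC HT Hdia Hstar; split.
    by move=> l; split; exact: multilinear_universal.
  move=> v u; exists (EM_duoidal HC HT Hdia Hstar v u).
  exists (Free_lax HC HT Hdia v), (Free_lax HC HT Hstar u); split.
    exact: EM_duoidal_induced.
  split; first exact: Free_lax_strong.
  split; first exact: Free_lax_strong.
  exact: Free_double_monoidal.
Qed.
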